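(* Let $M$ be an abelian group, let $P \subseteq M$ be a pixel set, and let $B_1, B_2 \subseteq M$ be structuring elements. Then: (a) If $B_1 \subseteq_{S,P,-} B_2$, then $O_{B_1}(g)^{-1}(0) \subseteq O_{B_2}(g)^{-1}(0)$ for every $g \in \mathcal{I}_P$. (b) If $B_1 \subseteq_{S,P,+} B_2$, then $C_{B_2}(g)^{-1}(0) \subseteq C_{B_1}(g)^{-1}(0)$ for every $g \in \mathcal{I}_P$. In particular, if $B_1 \subseteq_{S,P} B_2$, then for every $g \in \mathcal{I}_P$, $O_{B_1}(g)^{-1}(0) \subseteq O_{B_2}(g)^{-1}(0)$ and $C_{B_2}(g)^{-1}(0) \subseteq C_{B_1}(g)^{-1}(0)$.
   Context: $M$ is an abelian group (written additively, identity $0$). An image on a pixel set $P \subseteq M$ is a function $g : P \to \mathbb{R}_{\geq 0}$; $\mathcal{I}_P$ denotes the set of all images on $P$. A structuring element is a finite set $B$ with $0 \in B \subseteq M$. For $x \in P$ put $B(x;P,+) = \{ b \in B : x + b \in P\}$ and $B(x;P,-) = \{ b \in B : x - b \in P\}$. Erosion and dilation are $\epsilon_B, \delta_B : \mathcal{I}_P \to \mathcal{I}_P$, $\epsilon_B(g)(x) = \min\{ g(x+b) : b \in B(x;P,+)\}$, $\delta_B(g)(x) = \max\{ g(x-b) : b \in B(x;P,-)\}$. Opening is $O_B = \delta_B \circ \epsilon_B$ and closing is $C_B = \epsilon_B \circ \delta_B$. For an image $h$, $h^{-1}(0) = \{x \in P : h(x) = 0\}$. Shift inclusion: for structuring elements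 $B_1, B_2$, we write $B_1 \subseteq_{S,P,+} B_2$ if $B_1 \subseteq B_2$ and for every $x \in P$ and every $b_2 \in B_2(x;P,+)$ there is $b_1 \in B_1(x;P,+)$ with $B_1 + (b_2 - b_1) \subseteq B_2$. We write $B_1 \subseteq_{S,P,-} B_2$ if $B_1 \subseteq B_2$ and for every $x \in P$ and every $b_2 \in B_2(x;P,-)$ there is $b_1 \in B_1(x;P,-)$ with $B_1 + (b_2 - b_1) \subseteq B_2$. We write $B_1 \subseteq_{S,P} B_2$ if both $B_1 \subseteq_{S,P,+} B_2$ and $B_1 \subseteq_{S,P,-} B_2$ hold. Here $A + v = \{a + v : a \in A\}$. *)

(* Defs.v *)
From HB Require Import structures.
From mathcomp Require Import all_boot all_order all_algebra finmap.
From mathcomp Require Import all_classical reals interval_inference.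

Set Implicit Arguments.
Unset Strict Implicit.
Unset Printing Implicit Defensive.

Import Order.TTheory GRing.Theory Num.Theory.
Local Open Scope fset_scope.
Local Open Scope classical_set_scope.
Local Open Scope ring_scope.

Record structuring_element (M : zmodType) := StructuringElement {
  se_fset :> {fset M};
  se_0 : 0 \in se_fset
}.

Section Morphology.
Context {M : zmodType}.
Implicit Types (A : {fset M}) (B : structuring_element M) (P : set M).

Definition translate A (v : M) : {fset M} := [fset (a + v)%R | a in A]%fset.

(* B(x;P,+) and B(x;P,-) *)
Definition se_at_plus P B (x : M) : {fset M} :=
  [fset b in se_fset B | (x + b)%R \in P]%fset.
Definition se_at_minus P B (x : M) : {fset M} :=
  [fset b in se_fset B | (x - b)%R \in P]%fset.

Definition shift_incl_plus P B1 B2 : Prop :=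
  (B1 `<=` B2)%fset /\
  forall x, x \in P -> forall b2, b2 \in se_at_plus P B2 x ->
    exists2 b1, b1 \in se_at_plus P B1 x &
      (translate B1 (b2 - b1) `<=` B2)%fset.

Definition shift_incl_minus P B1 B2 : Prop :=
  (B1 `<=` B2)%fset /\
  forall x, x \in P -> forall b2, b2 \in se_at_minus P B2 x ->
    exists2 b1, b1 \in se_at_minus P B1 x &
      (translate B1 (b2 - b1) `<=` B2)%fset.

Definition shift_incl P B1 B2 : Prop :=
  shift_incl_plus P B1 B2 /\ shift_incl_minus P B1 B2.

End Morphology.

(* The pixel set [P] is coerced to the subtype of its elements. *)
Definition pixel_image (R : realType) (M : zmodType) (P : set M) :=
  P -> {nonneg R}.

Section Operators.
Context {R : realType} {M : zmodType} {P : set M}.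
Implicit Types (B : structuring_element M) (g : pixel_image R P).

(* [insubd x y] is [y] seen as an element of [P]; its default [x] is never used,
   since [y] is in [P] for the indices considered. The initial value [g x] of
   the iterated min (resp. max) is the term of index [0], as [0] is in [B]. *)
Definition erosion B g : pixel_image R P := fun x =>
  \big[Order.min/g x]_(b <- se_at_plus P B (val x)) g (insubd x (val x + b)).

Definition dilation B g : pixel_image R P := fun x =>
  \big[Order.max/g x]_(b <- se_at_minus P B (val x)) g (insubd x (val x - b)).

Definition opening B g : pixel_image R P := dilation B (erosion B g).
Definition closing B g : pixel_image R P := erosion B (dilation B g).

Definition zero_set g : set P := [set x | (g x)%:num = 0].

End Operators.

(* Main.v *)
(* Shift inclusion yields pointwise inequalities: O_B2 g <= O_B1 g and
   C_B1 g <= C_B2 g. For openings, let b1 be the element of B1 associated with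
   x and b2: the window x - b1 + B1 equals x - b2 + (B1 + (b2 - b1)), hence lies
   in x - b2 + B2, so the erosion by B2 at x - b2 is at most the erosion by B1
   at x - b1. Closings are dual. Images being nonnegative, the zero set is
   antitone in the image. *)

Require Import Defs.
From mathcomp Require Import all_boot all_order all_algebra finmap.
From mathcomp Require Import all_classical reals interval_inference.

Set Implicit Arguments.
Unset Strict Implicit.
Unset Printing Implicit Defensive.

Import Order.TTheory GRing.Theory Num.Theory.
Local Open Scope classical_set_scope.
Local Open Scope ring_scope.

Section MorphologyOrder.
Context {R : realType} {M : zmodType} {P : set M}.
Implicit Types (B : structuring_element M) (g : pixel_image R P) (x y : P).

Lemma insubd_pixel x y (z : M) : val y = z -> insubd x z = y.
Proof. by move=> <-; rewrite valKd. Qed.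

(** This bound and the next three give the universal properties of the iterated min and max.
    Neighbours are given as pixels [y] with a known [val y], so [insubd] no longer appears in the
    comparisons of operators. *)
Lemma erosion_le B g x y b :
  b \in se_fset B -> val y = val x + b -> erosion B g x <= g y.
Proof.
move=> bB yE; rewrite /erosion -(insubd_pixel x yE).
apply: bigmin_inf_seq (lexx _) => //.
by rewrite !inE /= bB -yE; apply: valP.
Qed.

Lemma le_erosion B g x t :
  (forall b y, b \in se_fset B -> val y = val x + b -> t <= g y) ->
  t <= erosion B g x.
Proof.
move=> tg; rewrite /erosion big_seq_cond; apply: le_bigmin => [|b].
  (* The initial value [g x] is covered by the offset 0. *)
  by apply: (tg 0); rewrite ?se_0 ?addr0.
rewrite andbT !inE /= => /andP[bB bP].
by apply: tg bB _; rewrite insubdK.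
Qed.

Lemma le_dilation B g x y b :
  b \in se_fset B -> val y = val x - b -> g y <= dilation B g x.
Proof.
move=> bB yE; rewrite /dilation -(insubd_pixel x yE).
apply: bigmax_sup_seq (lexx _) => //.
by rewrite !inE /= bB -yE; apply: valP.
Qed.

Lemma dilation_le B g x t :
  (forall b y, b \in se_fset B -> val y = val x - b -> g y <= t) ->
  dilation B g x <= t.
Proof.
move=> tg; rewrite /dilation big_seq_cond; apply: bigmax_le => [|b].
  by apply: (tg 0); rewrite ?se_0 ?subr0.
rewrite andbT !inE /= => /andP[bB bP].
by apply: tg bB _; rewrite insubdK.
Qed.

Lemma mem_translate (A C : {fset M}) v a :
  (translate A v `<=` C)%fset -> a \in A -> a + v \in C.
Proof. by move=> /fsubsetP sAC aA; apply/sAC/imfsetP; exists a. Qed.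

Lemma opening_le_shift_incl B1 B2 g x :
  shift_incl_minus P B1 B2 -> opening B2 g x <= opening B1 g x.
Proof.
move=> [_ sB]; apply: dilation_le => b2 y2 b2B y2E.
have [|b1] := sB _ (valP x) b2; first by rewrite !inE /= b2B -y2E; apply: valP.
rewrite !inE /= => /andP[b1B b1P] sb.
(* As [b1] is in the window restricted to [P], x - b1 is a pixel, and the outer maximum for [B1] has
   a term there. *)
have [y1 y1E] : exists y1 : P, val y1 = val x - b1.
  by exists (insubd x (val x - b1)); apply: insubdK.
apply: le_trans (le_dilation _ b1B y1E).
apply: le_erosion => c z cB zE.
(* The offset c + (b2 - b1) leads from [y2] to [z]. *)
apply: erosion_le (mem_translate sb cB) _.
by rewrite zE y1E y2E addrCA subrKA addrC.
Qed.

Lemma closing_le_shift_incl B1 B2 g x :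
  shift_incl_plus P B1 B2 -> closing B1 g x <= closing B2 g x.
Proof.
move=> [_ sB]; apply: le_erosion => b2 y2 b2B y2E.
have [|b1] := sB _ (valP x) b2; first by rewrite !inE /= b2B -y2E; apply: valP.
rewrite !inE /= => /andP[b1B b1P] sb.
have [y1 y1E] : exists y1 : P, val y1 = val x + b1.
  by exists (insubd x (val x + b1)); apply: insubdK.
apply: le_trans (erosion_le _ b1B y1E) _.
(* Here the windows are reflected: x + b1 - B1 = x + b2 - (B1 + (b2 - b1)) lies in x + b2 - B2. *)
apply: dilation_le => c z cB zE.
apply: le_dilation (mem_translate sb cB) _.
by rewrite zE y1E y2E opprD opprB addrCA (addrC b1) -!addrA addNKr [RHS]addrC -addrA.
Qed.

Lemma zero_set_antitone (f g : pixel_image R P) :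
  (forall x, f x <= g x) -> zero_set g `<=` zero_set f.
Proof.
(* The lower bound 0 comes from the type [{nonneg R}]; rewriting 0 back into [g x] leaves the
   hypothesis [fg], read in [R]. *)
move=> fg x /= gx0; apply/eqP; rewrite eq_le ge0 andbT -gx0.
by rewrite num_le.
Qed.

End MorphologyOrder.

Theorem theorem4 (R : realType) (M : zmodType) (P : set M)
    (B1 B2 : structuring_element M) :
  (shift_incl_minus P B1 B2 ->
     forall g : pixel_image R P,
       zero_set (opening B1 g) `<=` zero_set (opening B2 g)) /\
  (shift_incl_plus P B1 B2 ->
     forall g : pixel_image R P,
       zero_set (closing B2 g) `<=` zero_set (closing B1 g)) /\
  (shift_incl P B1 B2 ->
     forall g : pixel_image R P,
       zero_set (opening B1 g) `<=` zero_set (opening B2 g) /\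
       zero_set (closing B2 g) `<=` zero_set (closing B1 g)).
Proof.
have opn : shift_incl_minus P B1 B2 -> forall g : pixel_image R P,
    zero_set (opening B1 g) `<=` zero_set (opening B2 g).
  by move=> sB g; apply: zero_set_antitone => x; apply: opening_le_shift_incl.
have cls : shift_incl_plus P B1 B2 -> forall g : pixel_image R P,
    zero_set (closing B2 g) `<=` zero_set (closing B1 g).
  by move=> sB g; apply: zero_set_antitone => x; apply: closing_le_shift_incl.
by split=> //; split=> // -[sp sm] g; split; [apply: opn | apply: cls].
Qed.
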